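(* The property of having o-minimal open core is not elementary.
   Context: ''Definable'' always means definable with parameters. Let $\mathcal{R}=(R,<,\ldots)$ be a first-order structure expanding a dense linear order without endpoints. Give $R$ the order topology and each $R^n$ the product topology. The open core $\mathcal{R}^{\circ}$ of $\mathcal{R}$ is the structure with universe $R$ whose language consists of a relation symbol for each open set $U\subseteq R^n$, for every $n$, that is definable in $\mathcal{R}$. The structure $\mathcal{R}$ has o-minimal open core if $\mathcal{R}^{\circ}$ is o-minimal, i.e. every subset of $R$ definable in $\mathcal{R}^{\circ}$ is a finite union of points and intervals with endpoints in $R\cup\{-\infty,+\infty\}$. A property of structures is elementary if it is determined by the first-order theory of the structure, i.e. whenever two structures in the same language are elementarily equivalent and one has the property, so does the other. *)

(* Defs.v *)
From HB Require Import structures.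
From mathcomp Require Import all_boot all_order all_algebra.
From mathcomp Require Import all_classical topology.

Set Implicit Arguments.
Unset Strict Implicit.
Unset Printing Implicit Defensive.

Import Order.TTheory.

Local Open Scope classical_set_scope.
Local Open Scope order_scope.

Record language := Language {
  fun_sym : nat -> Type;
  rel_sym : nat -> Type
}.

Inductive term (L : language) (n : nat) : Type :=
| Var of 'I_n
| App k of fun_sym L k & ('I_k -> term L n).

(* [formula L n]: formulas whose free variables are among 'I_n.  In [All phi]
   variable 0 of [phi] is the bound one and variable [i.+1] of [phi] stands for
   variable [i] of [All phi].  The other connectives are classically definable. *)
Inductive formula (L : language) (n : nat) : Type :=
| Eq of term L n & term L n
| Rel k of rel_sym L k & ('I_k -> term L n)
| Bot
| Imp of formula L n & formula L n
| All of formula L n.+1.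

Arguments Bot {L n}.

Record structure (L : language) (T : Type) := Structure {
  fun_interp : forall k, fun_sym L k -> ('I_k -> T) -> T;
  rel_interp : forall k, rel_sym L k -> set ('I_k -> T)
}.

Definition env_nil (T : Type) (i : 'I_0) : T := False_rect T (notF (ltn_ord i)).

Definition env_cons (T : Type) (n : nat) (a : T) (v : 'I_n -> T) : 'I_n.+1 -> T :=
  fun i => if unlift ord0 i is Some j then v j else a.

Definition env_cat (T : Type) (m n : nat) (v : 'I_m -> T) (w : 'I_n -> T) :
    'I_(m + n) -> T :=
  fun i => match fintype.split i with inl j => v j | inr k => w k end.

Section Semantics.
Context (L : language) (T : Type) (M : structure L T).

Fixpoint eval (n : nat) (v : 'I_n -> T) (t : term L n) : T :=
  match t with
  | Var i => v i
  | App _ f ts => fun_interp M f (fun i => eval v (ts i))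
  end.

Fixpoint sat (n : nat) (v : 'I_n -> T) (phi : formula L n) : Prop :=
  match phi in formula _ _ return Prop with
  | Eq t u => eval v t = eval v u
  | Rel _ r ts => rel_interp M r (fun i => eval v (ts i))
  | Bot => False
  | Imp phi1 phi2 => sat v phi1 -> sat v phi2
  | All phi1 => forall a : T, sat (env_cons a v) phi1
  end.

Definition definable (n : nat) (X : set ('I_n -> T)) : Prop :=
  exists m (phi : formula L (n + m)) (p : 'I_m -> T),
    X = [set x | sat (env_cat x p) phi].

(* R is identified with R^1. *)
Definition definable1 (X : set T) : Prop :=
  definable [set x : 'I_1 -> T | X (x ord0)].

End Semantics.

Definition elementarily_equivalent (L : language) (T U : Type)
    (M : structure L T) (N : structure L U) : Prop :=
  forall phi : formula L 0, sat M (@env_nil T) phi <-> sat N (@env_nil U) phi.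

(* [interval T] also covers half-open and closed intervals. *)
Definition o_minimal (d : Order.disp_t) (T : orderType d) (L : language)
    (M : structure L T) : Prop :=
  forall X : set T, definable1 M X ->
    exists (pts : seq T) (itvs : seq (interval T)),
      X = [set` pts] `|` \bigcup_(i in [set` itvs]) [set` i].

Section OpenCore.
Context (d : Order.disp_t) (T : orderTopologicalType d).
Context (L : language) (M : structure L T).

Definition open_core_language : language :=
  {| fun_sym := fun=> void;
     rel_sym := fun n => {U : set {ptws 'I_n -> T} | open U /\ definable M U} |}.

Definition open_core : structure open_core_language T :=
  {| fun_interp := fun k (f : fun_sym open_core_language k) =>
       of_void (('I_k -> T) -> T) f;
     rel_interp := fun k (U : rel_sym open_core_language k) => sval U |}.

End OpenCore.

(* A language with a distinguished symbol [lt_sym], so that elementarily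
   equivalent structures interpret one and the same symbol as their order. *)
Record ordered_language := OrderedLanguage {
  base_language :> language;
  lt_sym : rel_sym base_language 2
}.

(* Expansions of (nonempty) dense linear orders without endpoints. *)
Record dlo_structure (L : ordered_language) := DloStructure {
  dlo_disp : Order.disp_t;
  dlo_carrier : orderTopologicalType dlo_disp;
  dlo_interp :> structure L dlo_carrier;
  dlo_lt : forall x : 'I_2 -> dlo_carrier,
    rel_interp dlo_interp (lt_sym L) x <-> x ord0 < x ord_max;
  dlo_dense : forall a b : dlo_carrier, a < b -> exists c, a < c < b;
  dlo_no_min : forall a : dlo_carrier, exists b, b < a;
  dlo_no_max : forall a : dlo_carrier, exists b, a < b;
  dlo_inhabited : inhabited dlo_carrier
}.

Definition has_o_minimal_open_core (L : ordered_language)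
    (M : dlo_structure L) : Prop :=
  o_minimal (open_core M).

Definition elementary (P : forall L : ordered_language, dlo_structure L -> Prop)
    : Prop :=
  forall (L : ordered_language) (M N : dlo_structure L),
    elementarily_equivalent M N -> P L M -> P L N.

(* Main.v *)
(* Consider the rationals with an equivalence relation all of whose classes are
   finite and which is generic: for any finite list of nonempty open intervals
   some class consists of exactly one point from each of them.

   Its open core is o-minimal.  Let U be an open set definable with parameters,
   and let C be the finite union of the classes of the parameters.  If w and v
   have the same order type over C, then by genericity w can be moved
   arbitrarily close to v by a finite partial isomorphism that fixes C and is
   closed under classes; such maps form a back-and-forth system, so they
   preserve U and its complement.  As U is open, it is therefore invariant under
   finite partial order isomorphisms fixing C.  This passes to all sets
   definable in the open core, and an invariant subset of the line is a finite
   union of points and intervals.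

   In an ultrapower, a sequence of classes of sizes 0, 1, 2, ... yields an
   infinite definable set that is still closed and discrete, so the open core of
   the ultrapower is not o-minimal. *)

From HB Require Import structures.
From mathcomp Require Import all_boot all_order all_algebra generic_quotient.
From mathcomp Require Import lra.
From mathcomp Require Import all_classical topology.
Require Import Defs.

Set Implicit Arguments.
Unset Strict Implicit.
Unset Printing Implicit Defensive.

Import Order.TTheory GRing.Theory Num.Theory.

Local Open Scope classical_set_scope.
Local Open Scope ring_scope.
Local Open Scope quotient_scope.

(** * Partial isomorphisms *)

Section OrderIso.
Context (R : realFieldType).
Implicit Types (s t : seq (R * R)) (L U A : seq R) (a b x y e : R).

Lemma lower_strict_bound U : exists b, {in U, forall u, b < u}.
Proof.
elim: U => [|u U [b bU]]; first by exists 0.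
exists (Num.min b u - 1) => v; rewrite inE => /orP[/eqP ->|/bU bv].
  by rewrite ltrBlDr gt_min ltrDl ltr01 orbT.
by rewrite ltrBlDr gt_min (lt_le_trans bv) // lerDl ler01.
Qed.

Lemma separate_above a U : {in U, forall u, a < u} ->
  exists2 b, a < b & {in U, forall u, b < u}.
Proof.
elim: U => [_|u U IH aU]; first by exists (a + 1) => //; lra.
have [|b ab bU] := IH; first by move=> v vU; apply: aU; rewrite inE vU orbT.
have au : a < u by apply: aU; rewrite mem_head.
exists (Num.min b ((a + u) / 2)); first by rewrite lt_min ab; lra.
move=> v; rewrite gt_min inE => /orP[/eqP ->|/bU ->//].
by apply/orP; right; lra.
Qed.

(** Density and absence of endpoints at once, since either list may be empty. The separating point
    is raised whenever a new lower element reaches it. *)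
Lemma separate L U : {in L & U, forall l u, l < u} ->
  exists b, {in L, forall l, l < b} /\ {in U, forall u, b < u}.
Proof.
elim: L => [_|l L IH LU].
  by have [b bU] := lower_strict_bound U; exists b.
have [|b [Lb bU]] := IH.
  by move=> k u kL uU; apply: LU => //; rewrite inE kL orbT.
have [lb|bl] := ltP l b.
  by exists b; split=> // k; rewrite inE => /orP[/eqP ->|/Lb].
have [|c lc cU] := @separate_above l U.
  by move=> u uU; apply: LU => //; rewrite mem_head.
exists c; split=> // k; rewrite inE => /orP[/eqP ->//|/Lb kb].
exact: lt_trans kb (le_lt_trans bl lc).
Qed.

(** A finite partial map is the list of its pairs. As the order is total, the condition also makes
    it single-valued and injective. *)
Definition order_iso s := {in s &, forall p q, (p.1 < q.1) = (p.2 < q.2)}.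

Lemma order_iso_eq s : order_iso s ->
  {in s &, forall p q, (p.1 == q.1) = (p.2 == q.2)}.
Proof.
move=> os p q ps qs; have := os p q ps qs; have := os q p qs ps.
by case: (ltgtP p.1 q.1); case: (ltgtP p.2 q.2).
Qed.

Lemma order_isoI s :
  {in s &, forall p q, p.1 < q.1 -> p.2 < q.2} ->
  {in s &, forall p q, p.1 = q.1 -> p.2 = q.2} -> order_iso s.
Proof.
move=> lts eqs p q ps qs; apply/idP/idP; first exact: lts.
case: (ltgtP p.1 q.1) => // [/(lts _ _ qs ps) qp pq|/(eqs _ _ ps qs) ->].
  by have := lt_trans pq qp; rewrite ltxx.
by rewrite ltxx.
Qed.

Definition inverse s := [seq (p.2, p.1) | p <- s].

Lemma mem_inverse s a b : ((a, b) \in inverse s) = ((b, a) \in s).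
Proof.
apply/mapP/idP => [[[c d] cds [-> ->]]//|bas]; by exists (b, a).
Qed.

Lemma inverseP s p : p \in inverse s -> (p.2, p.1) \in s.
Proof. by case: p => a b; rewrite mem_inverse. Qed.

Lemma order_iso_inverse s : order_iso s -> order_iso (inverse s).
Proof. by move=> os p q /inverseP ps /inverseP qs; have /= -> := os _ _ ps qs. Qed.

(** The image of [a] is put in the gap between the images of the points below [a] and those of the
    points above. *)
Lemma order_iso_extend s a : order_iso s ->
  exists t, [/\ {subset s <= t}, order_iso t & a \in unzip1 t].
Proof.
move=> os; have [as1|as1] := boolP (a \in unzip1 s); first by exists s; split.
have [|b [Lb bU]] := @separate
    [seq p.2 | p <- s & p.1 < a] [seq p.2 | p <- s & a < p.1].
  move=> _ _ /mapP[p + ->] /mapP[q + ->]; rewrite !mem_filter.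
  by move=> /andP[pa ps] /andP[aq qs]; rewrite -os // (lt_trans pa aq).
have {}Lb p : p \in s -> p.1 < a -> p.2 < b.
  by move=> ps pa; apply: Lb; apply: map_f; rewrite mem_filter pa.
have {}bU p : p \in s -> a < p.1 -> b < p.2.
  by move=> ps pa; apply: bU; apply: map_f; rewrite mem_filter pa.
have Na p : p \in s -> p.1 <> a.
  by move=> ps pa; case/negP: as1; rewrite -pa map_f.
exists ((a, b) :: s); split; last exact: mem_head.
  by move=> p ps; rewrite inE ps orbT.
apply: order_isoI => p q; rewrite !inE.
  move=> /orP[/eqP->|ps] /orP[/eqP->|qs] /=; first by rewrite ltxx.
  - exact: bU.
  - exact: Lb.
  by rewrite os.
move=> /orP[/eqP->|ps] /orP[/eqP->|qs] //=.
- by move=> /esym/(Na _ qs).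
- by move=> /(Na _ ps).
by move=> /eqP; rewrite (order_iso_eq os) // => /eqP.
Qed.

Lemma order_iso_extends s A : order_iso s ->
  exists t, [/\ {subset s <= t}, order_iso t & {subset A <= unzip1 t}].
Proof.
elim: A s => [|a A IH] s os; first by exists s; split.
have [s' [ss' os' as']] := order_iso_extend a os.
have [t [s't ot At]] := IH s' os'.
exists t; split=> //; first by move=> p /ss'/s't.
move=> x; rewrite inE => /orP[/eqP ->|/At//].
by have /mapP[p ps' ->] := as'; apply/map_f/s't.
Qed.

(** For an order isomorphism [t], one point chosen within [e] of each image stays in the order of
    the images. *)
Definition gap_bound t e :=
  {in t &, forall p q, p.1 < q.1 -> p.2 + e < q.2 - e}.

Lemma exists_gap_bound t e : order_iso t -> 0 < e ->
  exists d, [/\ 0 < d, d < e & gap_bound t d].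
Proof.
move=> ot e0.
(* It suffices that [d] lie below [e] and below half of each of the finitely many positive gaps
   between images. *)
have [|d d0 dU] := @separate_above 0
    (e :: [seq (pq.2.2 - pq.1.2) / 2 |
            pq <- [seq (p, q) | p <- t, q <- t] & pq.1.1 < pq.2.1]).
  move=> u; rewrite inE => /orP[/eqP ->//|/mapP[[p q] + ->]].
  rewrite mem_filter /= => /andP[pq /allpairsP[[p' q'] /= [p't q't [pp qq]]]].
  by subst p' q'; move: pq; rewrite ot //; lra.
exists d; split=> //; first by apply: dU; rewrite mem_head.
move=> p q pt qt pq.
suff : d < (q.2 - p.2) / 2 by lra.
apply: dU; rewrite inE; apply/orP; right; apply/mapP; exists (p, q) => //.
by rewrite mem_filter /= pq; apply/allpairsP; exists (p, q).
Qed.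

Definition perturbs e s t :=
  {in s, forall p, exists2 b, (p.1, b) \in t & b - e < p.2 < b + e}.

Lemma perturbs_lt e s t : gap_bound t e -> perturbs e s t ->
  {in s &, forall p q, p.1 < q.1 -> p.2 < q.2}.
Proof.
move=> gt st p q /st[b bt /andP[_ pb]] /st[c ct /andP[cq _]] pq.
exact: lt_trans pb (lt_trans (gt _ _ bt ct pq) cq).
Qed.

End OrderIso.

(** * Partial isomorphisms respecting the classes *)

Section ClassIso.
Context (R : realFieldType) (K : R -> seq R).
Implicit Types (s t : seq (R * R)) (A : seq R) (a b x y e : R).

(* [K x] lists the class of [x].  The intervals [I] in the last clause may
   overlap. *)
Definition generic_classes :=
  [/\ forall x, x \in K x, forall x, uniq (K x),
      forall x y, y \in K x -> K y = K x
    & forall I : seq (R * R), {in I, forall i, i.1 < i.2} ->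
      exists b : seq R, [/\ size b = size I, uniq b,
        {in b, forall x, K x = b}
        & forall i, (i < size I)%N ->
            (nth (0, 0) I i).1 < b`_i < (nth (0, 0) I i).2]].

(** Domain and range are closed under classes, so a new point brings a whole new class, on which the
    old pairs impose only order conditions. *)
Definition class_iso s :=
  [/\ order_iso s,
      {in s &, forall p q, (q.1 \in K p.1) = (q.2 \in K p.2)},
      {in s, forall p, {subset K p.1 <= unzip1 s}}
    & {in s, forall p, {subset K p.2 <= unzip2 s}}].

Lemma class_iso_inverse s : class_iso s -> class_iso (inverse s).
Proof.
move=> [os Ks K1 K2]; split.
- exact: order_iso_inverse.
- by move=> p q /inverseP ps /inverseP qs; have /= -> := Ks _ _ ps qs.
- by move=> p /inverseP/K2; rewrite /unzip1 /unzip2 -map_comp.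
- by move=> p /inverseP/K1; rewrite /unzip1 /unzip2 -map_comp.
Qed.

Hypothesis Kgen : generic_classes.

Let Kxx x : x \in K x. Proof. by case: Kgen. Qed.

Let K_eq x y : y \in K x -> K y = K x. Proof. by case: Kgen => _ _ /(_ x y). Qed.

Let KC x y : (x \in K y) = (y \in K x).
Proof. by apply/idP/idP => /K_eq e; rewrite ?e // -e. Qed.

(* Genericity provides a class with exactly one element in each
   [e]-neighbourhood of the images under [t] of the elements of [K a]. *)
Lemma class_iso_perturb s t e a :
    order_iso t -> 0 < e -> gap_bound t e -> class_iso s -> perturbs e s t ->
    {subset K a <= unzip1 t} ->
  exists s', [/\ {subset s <= s'}, class_iso s', perturbs e s' t
               & a \in unzip1 s'].
Proof.
move=> ot e0 gt [os Ks K1 K2] st Kat.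
have [as1|as1] := boolP (a \in unzip1 s); first by exists s; split.
(* On the domain of [t], [h] is the map [t] itself, read off from the list of pairs. *)
pose h x := (unzip2 t)`_(index x (unzip1 t)).
have hP x : x \in K a -> (x, h x) \in t.
  move=> /Kat xt; pose i := index x (unzip1 t).
  have it : (i < size t)%N by rewrite -(size_map fst) index_mem.
  rewrite /h -{1}[x](nth_index 0 xt) -/i.
  rewrite (nth_map (0, 0)) // (nth_map (0, 0)) // -surjective_pairing.
  exact: mem_nth.
case: (Kgen) => _ Kuniq _ /(_ [seq (h x - e, h x + e) | x <- K a]) [].
  by move=> _ /mapP[x _ ->] /=; lra.
move=> b; rewrite size_map => -[sb ub Kb bI].
have zP p : p \in zip (K a) b -> exists i,
    [/\ (i < size (K a))%N, p.1 = (K a)`_i & p.2 = b`_i].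
  move=> /(nthP (0, 0))[i]; rewrite size_zip sb minnn => ib <-.
  by exists i; rewrite nth_zip.
have z1 p : p \in zip (K a) b -> p.1 \in K a.
  by move=> /zP[i [ia -> _]]; apply: mem_nth.
have z2 p : p \in zip (K a) b -> p.2 \in b.
  by move=> /zP[i [ia _ ->]]; apply: mem_nth; rewrite sb.
have unz1 : unzip1 (zip (K a) b) = K a by rewrite unzip1_zip ?sb.
have unz2 : unzip2 (zip (K a) b) = b by rewrite unzip2_zip ?sb.
(* The class of [a] avoids the classes in the domain of [s]: the domain is closed under classes and
   omits [a]. *)
have Ns x p : x \in K a -> p \in s -> x \notin K p.1.
  move=> xa ps; apply: contra as1 => /K_eq xp; apply: (K1 _ ps).
  by rewrite -xp (K_eq xa).
have st' : perturbs e (zip (K a) b ++ s) t.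
  move=> p; rewrite mem_cat => /orP[pz|/st//].
  exists (h p.1); first exact/hP/z1.
  have [i [ia p1 p2]] := zP p pz; have := bI i ia.
  by rewrite (nth_map 0) //= p1 p2.
have os' : order_iso (zip (K a) b ++ s).
  apply: order_isoI; first exact: perturbs_lt gt st'.
  move=> p q; rewrite !mem_cat => /orP[pz|ps] /orP[qz|qs].
  - have [i [ia -> ->]] := zP p pz; have [j [ja -> ->]] := zP q qz.
    by move=> /eqP; rewrite nth_uniq // => /eqP ->.
  - by move=> pq; have := Ns _ _ (z1 _ pz) qs; rewrite pq Kxx.
  - by move=> pq; have := Ns _ _ (z1 _ qz) ps; rewrite pq Kxx.
  - by move=> /eqP; rewrite (order_iso_eq os) // => /eqP.
(* The new class [b] avoids the classes in the range of [s]: a common point would lie in the range,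
   and injectivity of the enlarged map would put an element of [K a] into the old domain. *)
have Ns2 y p : y \in b -> p \in s -> y \notin K p.2.
  move=> yb ps; apply/negP => /(K2 _ ps)/mapP[q qs yq].
  have [r rz ry] : exists2 r, r \in zip (K a) b & r.2 = y.
    by move: yb; rewrite -{1}unz2 => /mapP[r rz ->]; exists r.
  have := order_iso_eq os' (x := r) (y := q); rewrite !mem_cat rz qs orbT.
  move=> /(_ isT isT); rewrite ry yq eqxx => /eqP rq.
  by have := Ns _ _ (z1 _ rz) qs; rewrite rq Kxx.
exists (zip (K a) b ++ s); split=> //.
- by move=> p ps; rewrite mem_cat ps orbT.
- split=> //.
  + move=> p q; rewrite !mem_cat => /orP[pz|ps] /orP[qz|qs].
    * by rewrite (K_eq (z1 _ pz)) (Kb _ (z2 _ pz)) z1 // z2.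
    * rewrite KC (negbTE (Ns _ _ (z1 _ pz) qs)).
      by rewrite KC (negbTE (Ns2 _ _ (z2 _ pz) qs)).
    * rewrite (negbTE (Ns _ _ (z1 _ qz) ps)).
      by rewrite (negbTE (Ns2 _ _ (z2 _ qz) ps)).
    * exact: Ks.
  + move=> p; rewrite mem_cat => /orP[pz|ps] x.
      by rewrite (K_eq (z1 _ pz)) /unzip1 map_cat mem_cat -/unzip1 unz1 => ->.
    by move=> /(K1 _ ps); rewrite /unzip1 map_cat mem_cat => ->; rewrite orbT.
  + move=> p; rewrite mem_cat => /orP[pz|ps] x.
      by rewrite (Kb _ (z2 _ pz)) /unzip2 map_cat mem_cat -/unzip2 unz2 => ->.
    by move=> /(K2 _ ps); rewrite /unzip2 map_cat mem_cat => ->; rewrite orbT.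
- by rewrite /unzip1 map_cat mem_cat -/unzip1 unz1 Kxx.
Qed.

Lemma class_iso_perturbs s t e A :
    order_iso t -> 0 < e -> gap_bound t e -> class_iso s -> perturbs e s t ->
    {in A, forall a, {subset K a <= unzip1 t}} ->
  exists s', [/\ {subset s <= s'}, class_iso s', perturbs e s' t
               & {subset A <= unzip1 s'}].
Proof.
move=> ot e0 gt; elim: A s => [|a A IH] s is_ st At; first by exists s; split.
have [|s1 [ss1 is1 s1t as1]] := class_iso_perturb ot e0 gt is_ st (a := a).
  by apply: At; rewrite mem_head.
have [|s2 [s12 is2 s2t As2]] := IH s1 is1 s1t.
  by move=> x xA; apply: At; rewrite inE xA orbT.
exists s2; split=> //; first by move=> p /ss1/s12.
move=> x; rewrite inE => /orP[/eqP ->|/As2//].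
by have /mapP[p ps1 ->] := as1; apply/map_f/s12.
Qed.

(** First [s] is extended to [K a] as a mere order isomorphism [t]. Since [s] agrees with [t] on its
    domain, it is a perturbation of [t] and extends by a perturbed copy of the class of [a]. *)
Lemma class_iso_extend s a : class_iso s ->
  exists s' b, [/\ {subset s <= s'}, class_iso s' & (a, b) \in s'].
Proof.
move=> is_; have [os _ _ _] := is_.
have [t [st ot Kat]] := order_iso_extends (K a) os.
have [e [e0 _ gt]] := exists_gap_bound ot ltr01.
have [|s' [ss' is' _ /mapP[p ps' ->]]] :=
    class_iso_perturb ot e0 gt is_ (a := a) _ Kat.
  by move=> p /st pt; exists p.2; [rewrite -surjective_pairing | lra].
by exists s', p.2; split=> //; rewrite -surjective_pairing.
Qed.

Lemma class_iso_diag A :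
  {in A, forall x, {subset K x <= A}} -> class_iso [seq (x, x) | x <- A].
Proof.
move=> KA; split.
- by move=> _ _ /mapP[x _ ->] /mapP[y _ ->].
- by move=> _ _ /mapP[x _ ->] /mapP[y _ ->].
- move=> _ /mapP[x xA ->] /=; rewrite /unzip1 -map_comp map_id_in //.
  exact: KA.
- move=> _ /mapP[x xA ->] /=; rewrite /unzip2 -map_comp map_id_in //.
  exact: KA.
Qed.

End ClassIso.

(** * Existence of generic classes *)

Lemma fresh_between (A : seq rat) (I : rat * rat) : I.1 < I.2 ->
  exists x, x \notin A /\ I.1 < x < I.2.
Proof.
move=> I12; have [|x Ix xI] :=
    @separate_above _ I.1 (I.2 :: [seq a <- A | I.1 < a]).
  by move=> u; rewrite inE mem_filter => /orP[/eqP ->//|/andP[]].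
exists x; rewrite Ix xI ?mem_head //; split=> //; apply/negP => xA.
by have := xI x; rewrite inE mem_filter Ix xA orbT ltxx => /(_ isT).
Qed.

Lemma injective_selection (S : nat -> rat * rat) :
    (forall n, (S n).1 < (S n).2) ->
  exists2 g : nat -> rat, injective g & forall n, (S n).1 < g n < (S n).2.
Proof.
move=> SP.
have /choice[f fP] (An : seq rat * nat) :
    exists x, x \notin An.1 /\ (S An.2).1 < x < (S An.2).2.
  exact: fresh_between.
(* Greedy choice: [prev n] lists the values picked before stage [n], and [f] picks a point of the
   next interval outside that finite list. *)
pose fix prev n := if n is m.+1 then f (prev m, m) :: prev m else [::].
have prevP m n : (m < n)%N -> f (prev m, m) \in prev n.
  elim: n => // n IH; rewrite ltnS leq_eqVlt => /orP[/eqP ->|/IH mn] /=.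
    exact: mem_head.
  by rewrite inE mn orbT.
exists (fun n => f (prev n, n)) => [|n]; last by have [] := fP (prev n, n).
move=> m n fmn; have [mn|nm|//] := ltngtP m n.
  by have [] := fP (prev n, n); rewrite -{1}fmn prevP.
by have [] := fP (prev m, m); rewrite {1}fmn prevP.
Qed.

(** There are countably many pairs of a finite list [J] of intervals and a position in it. An
    injective choice of a point for each pair makes the points of [J] a class [b J]; all remaining
    points form singletons. *)
Lemma generic_classes_exist : exists K : rat -> seq rat, generic_classes K.
Proof.
(* The interval [(0, 1)] stands in for empty intervals and for numbers that code no pair, so that
   every stage has a point to choose. *)
pose valid (I : rat * rat) := if I.1 < I.2 then I else (0, 1).
pose S n : rat * rat := if unpickle n is Some (J, i) then
  valid (nth (0, 0) (J : seq (rat * rat)) i) else (0, 1).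
have [|g ginj gS] := @injective_selection S.
  move=> n; rewrite /S; case: unpickle => [[J i]|//].
  by rewrite /valid; case: ifP.
pose c (J : seq (rat * rat)) (i : nat) := g (pickle (J, i)).
have cinj J i J' i' : c J i = c J' i' -> (J, i) = (J', i').
  by move=> /ginj/(pcan_inj pickleK).
pose b J := mkseq (c J) (size J).
have bdisj J J' x : x \in b J -> x \in b J' -> J = J'.
  by move=> /mapP[i _ ->] /mapP[i' _ /cinj[]].
pose K x := if pselect (exists J, x \in b J) is left e
  then b (projT1 (cid e)) else [:: x].
(* The list chosen in the definition of [K x] is the only one possible, by disjointness of the
   classes [b J]. *)
have Kb J x : x \in b J -> K x = b J.
  rewrite /K => xJ; case: pselect => [e|[]]; last by exists J.
  by rewrite (bdisj _ _ _ xJ (projT2 (cid e))).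
have ub J : uniq (b J).
  by apply/mkseq_uniqP => i i' _ _ /cinj[].
exists K; split.
- move=> x; rewrite /K; case: pselect => [e|_]; last exact: mem_head.
  exact: projT2 (cid e).
- by move=> x; rewrite /K; case: pselect.
- move=> x y; rewrite {1}/K; case: pselect => [e|Ne].
    move=> yb; rewrite (Kb _ _ yb); apply/esym/Kb.
    exact: projT2 (cid e).
  by rewrite inE => /eqP ->.
- move=> I IP; exists (b I); rewrite size_mkseq; split=> //.
    by move=> x /Kb.
  move=> i iI; rewrite nth_mkseq //.
  by have := gS (pickle (I, i)); rewrite /S pickleK /valid IP // mem_nth.
Qed.

(** * Back-and-forth *)

Section Environments.
Context (T U : Type) (P : T -> U -> Prop).

Lemma env_cons_rel n a b (v : 'I_n -> T) (w : 'I_n -> U) :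
  P a b -> (forall i, P (v i) (w i)) ->
  forall i, P (env_cons a v i) (env_cons b w i).
Proof. by move=> Pab Pvw i; rewrite /env_cons; case: unlift. Qed.

Lemma env_cat_rel m n (v : 'I_m -> T) (v' : 'I_m -> U)
    (w : 'I_n -> T) (w' : 'I_n -> U) :
  (forall i, P (v i) (v' i)) -> (forall i, P (w i) (w' i)) ->
  forall i, P (env_cat v w i) (env_cat v' w' i).
Proof. by move=> Pv Pw i; rewrite /env_cat; case: fintype.split. Qed.

End Environments.

Lemma env_cat_lshift (T : Type) m n (v : 'I_m -> T) (w : 'I_n -> T) i :
  env_cat v w (lshift n i) = v i.
Proof. by rewrite /env_cat; have /= -> := @unsplitK m n (inl i). Qed.

Lemma env_cat_rshift (T : Type) m n (v : 'I_m -> T) (w : 'I_n -> T) i :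
  env_cat v w (rshift m i) = w i.
Proof. by rewrite /env_cat; have /= -> := @unsplitK m n (inr i). Qed.


(** * Structures with an order and a class relation *)

Inductive class_symbol : nat -> Type :=
| LtSym : class_symbol 2
| ClassSym : class_symbol 2.

Definition class_language : ordered_language :=
  {| base_language := {| fun_sym := fun=> void; rel_sym := class_symbol |};
     lt_sym := LtSym |}.

Definition class_structure (R : realFieldType) (K : R -> seq R) :
    structure class_language R :=
  {| fun_interp := fun k (f : fun_sym class_language k) =>
       of_void (('I_k -> R) -> R) f;
     rel_interp := fun k (r : rel_sym class_language k) =>
       match r in class_symbol k return set ('I_k -> R) with
       | LtSym => [set x | x ord0 < x ord_max]
       | ClassSym => [set x | x ord_max \in K (x ord0)]
       end |}.

Section OpenCoreOfClasses.
Context (R : realFieldType) (K : R -> seq R).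
Hypothesis Kgen : generic_classes K.
Let M := class_structure K.

(** Class isomorphisms form a back-and-forth system. Terms are just variables, as the language has
    no function symbols. *)
Lemma sat_class_iso n (phi : formula class_language n) (v w : 'I_n -> R)
    (s : seq (R * R)) :
  class_iso K s -> (forall i, (v i, w i) \in s) -> sat M v phi <-> sat M w phi.
Proof.
elim: phi v w s => {n} [n t u|n k r ts||n f IHf g IHg|n f IH] v w s ks svw.
- have eP (t' : term class_language n) : (eval M v t', eval M w t') \in s.
    by case: t' => [i|k []]; apply: svw.
  have [os _ _ _] := ks.
  by split=> /eqP; [rewrite (order_iso_eq os (eP t) (eP u)) |
    rewrite -(order_iso_eq os (eP t) (eP u))] => /eqP.
- have eP (t' : term class_language n) : (eval M v t', eval M w t') \in s.
    by case: t' => [i|k' []]; apply: svw.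
  have [os Ks _ _] := ks.
  case: r ts => ts /=.
    by have /= -> := os _ _ (eP (ts ord0)) (eP (ts ord_max)).
  by have /= -> := Ks _ _ (eP (ts ord0)) (eP (ts ord_max)).
- by [].
- by have := IHf _ _ _ ks svw; have := IHg _ _ _ ks svw => /=; tauto.
(* A point [a] on the side of [w] is matched by extending the inverse map; a point on the side of
   [v] by extending [s]. *)
- split=> /= H a.
    have [s' [b [ss' ks' abs']]] := class_iso_extend Kgen a (class_iso_inverse ks).
    apply/(IH (env_cons b v) _ _ (class_iso_inverse ks')); last exact: H.
    apply: (env_cons_rel (P := fun x y => (x, y) \in _)) => [|i];
      rewrite mem_inverse //.
    by apply: ss'; rewrite mem_inverse.
  have [s' [b [ss' ks' abs']]] := class_iso_extend Kgen a ks.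
  apply/(IH _ (env_cons b w) _ ks'); last exact: H.
  by apply: (env_cons_rel (P := fun x y => (x, y) \in _)) => // i; apply: ss'.
Qed.

End OpenCoreOfClasses.

(** * The open core of a generic structure *)

Section Topology.
Context (R : realFieldType).

Lemma common_radius (a b : R) : 0 < a -> 0 < b ->
  exists2 e, 0 < e & e <= a /\ e <= b.
Proof.
move=> a0 b0; exists (Num.min a b); first by rewrite lt_min a0.
by rewrite !ge_min !lexx orbT.
Qed.

(** Basic neighbourhoods in the order topology are intervals with open or infinite ends; this turns
    them into symmetric balls. *)
Lemma itv_open_ends_ball (i : interval R) (x : R) :
  itv_open_ends i -> x \in i ->
  exists2 e, 0 < e & forall y, x - e < y < x + e -> y \in i.
Proof.
move: i => [[[]l|[]] [[]r|[]]] //= _; rewrite in_itv /= ?andbT.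
- move=> /andP[lx xr]; have [||e e0 [el er]] := @common_radius (x - l) (r - x).
  + by rewrite subr_gt0.
  + by rewrite subr_gt0.
  by exists e => // y; rewrite in_itv /=; lra.
- by move=> lx; exists (x - l) => [|y]; rewrite ?in_itv /=; lra.
- by move=> xr; exists (r - x) => [|y]; rewrite ?in_itv /=; lra.
- by exists 1.
Qed.

Lemma open_ptws_ball n (U : set {ptws 'I_n -> order_topology R})
    (x : 'I_n -> R) : open U -> U x ->
  exists2 e, 0 < e &
    forall y : 'I_n -> R, (forall i, x i - e < y i < x i + e) -> U y.
Proof.
move=> oU Ux.
(* The cubes around [x] generate a filter. It converges to [x] in the product topology because it
   does so in each coordinate, hence an open set around [x] contains a cube. *)
pose B e := [set y : 'I_n -> R | forall i, x i - e < y i < x i + e].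
pose F := filter_from [set e | 0 < e] B.
have FF : Filter F.
  apply: filter_from_filter; first by exists 1; rewrite /= ltr01.
  move=> e f /= e0 f0; have [d d0 [de df]] := common_radius e0 f0.
  by exists d => // y Bd; split=> i; have := Bd i; lra.
have : F --> (x : {ptws 'I_n -> order_topology R}).
  apply/cvg_sup => i V [_ [[W] oW <-] Wx WV].
  have : nbhs (x i : order_topology R) W by exact: open_nbhs_nbhs.
  rewrite itv_nbhsE => -[j [oj xj] jW].
  have [e e0 ej] := itv_open_ends_ball oj xj.
  by exists e => // y By; apply/WV/jW/ej/By.
move=> /(_ U); case=> [|e e0 BU]; first exact: open_nbhs_nbhs.
by exists e => // y By; apply: BU.
Qed.
End Topology.


Section OpenDefinable.
Context (R : realFieldType) (K : R -> seq R).
Hypothesis Kgen : generic_classes K.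
Let M : structure class_language (order_topology R) := class_structure K.

(** Such an [s] exists exactly when [v] and [w] have the same order type over [C]. *)
Definition invariant_over (C : seq R) n (X : set ('I_n -> R)) :=
  forall (s : seq (R * R)) (v w : 'I_n -> R), order_iso s ->
    {in C, forall c, (c, c) \in s} -> (forall i, (v i, w i) \in s) ->
    X v -> X w.

(* The map [w i -> v i] extends to the classes of the [w i]; by genericity this
   extension can be perturbed into a class isomorphism fixing the parameters,
   which moves [w] into any given neighbourhood of [v]. *)
Lemma open_definable_invariant n (U : set {ptws 'I_n -> order_topology R}) :
  open U -> definable M U -> exists C, invariant_over C (U : set ('I_n -> R)).
Proof.
move=> oU [m [phi [p defU]]]; pose C := flatten [seq K (p i) | i <- enum 'I_m].
have [Kxx _ Keq _] := Kgen.
have pC i : p i \in C.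
  by apply/flatten_mapP; exists i; rewrite ?mem_enum.
have KC : {in C, forall x, {subset K x <= C}}.
  move=> x /flatten_mapP[i _ xp] y; rewrite (Keq _ _ xp) => yp.
  by apply/flatten_mapP; exists i; rewrite ?mem_enum.
exists C => s v w os Cs svw Uv.
have [e e0 vU] := open_ptws_ball oU Uv.
have [t [st ot Kt]] := order_iso_extends
  (flatten [seq K (w i) | i <- enum 'I_n]) (order_iso_inverse os).
have [d [d0 de gt]] := exists_gap_bound ot e0.
have Ct c : c \in C -> (c, c) \in t.
  by move=> /Cs cs; apply: st; rewrite mem_inverse.
(* The identity on [C] agrees with [t] there, so it can be extended to all [w i] by a class
   isomorphism staying within [d] of [t]. *)
have [||s' [Cs' ks' s't ws']] := class_iso_perturbs Kgen ot d0 gt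
    (class_iso_diag KC) _ (A := [seq w i | i <- enum 'I_n]).
- by move=> _ /mapP[c cC ->] /=; exists c; [exact: Ct | lra].
- move=> _ /mapP[i _ ->] x xw; apply: Kt.
  by apply/flatten_mapP; exists i; rewrite ?mem_enum.
have /choice[u us'] i : exists y, (w i, y) \in s'.
  have /ws'/mapP[[x y] xys' ->] : w i \in [seq w i | i <- enum 'I_n].
    by apply: map_f; rewrite mem_enum.
  by exists y.
have Uu : U u.
  apply: vU => i; have [b /= bt bu] := s't _ (us' i).
  have wvt : (w i, v i) \in t by apply: st; rewrite mem_inverse.
  have /= := order_iso_eq ot bt wvt; rewrite eqxx => /esym/eqP bv.
  by move: bu; rewrite bv; lra.
have -> : U = [set x | sat M (env_cat x p) phi] by [].
(* The map [s'] fixes the parameters and sends [w] to [u], a point of [U] near [v]; thus [w]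
   satisfies [phi] as well. *)
apply/(sat_class_iso Kgen _ ks' (w := env_cat u p)); last by rewrite defU in Uu.
apply: (env_cat_rel (P := fun x y => (x, y) \in _)) => // i.
by apply: Cs'; apply/mapP; exists (p i).
Qed.

(** Atomic relations are invariant because they are open and definable. Finite order isomorphisms
    extend to any further point, so quantifiers preserve invariance over the same [C]. *)
Lemma sat_open_core_iso n (phi : formula (open_core_language M) n) :
  exists C : seq R, forall (s : seq (R * R)) (v w : 'I_n -> R), order_iso s ->
    {in C, forall c, (c, c) \in s} -> (forall i, (v i, w i) \in s) ->
    sat (open_core M) v phi <-> sat (open_core M) w phi.
Proof.
elim: phi => {n} [n t u|n k r ts||n f [C IHf] g [D IHg]|n f [C IH]].
- exists [::] => s v w os _ svw.
  have eP (t' : term (open_core_language M) n) :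
      (eval (open_core M) v t', eval (open_core M) w t') \in s.
    by case: t' => [i|k []]; apply: svw.
  by split=> /eqP; [rewrite (order_iso_eq os (eP t) (eP u)) |
    rewrite -(order_iso_eq os (eP t) (eP u))] => /eqP.
- have [oU dU] := svalP r.
  have [C CU] := open_definable_invariant oU dU.
  exists C => s v w os Cs svw.
  have eP (t' : term (open_core_language M) n) :
      (eval (open_core M) v t', eval (open_core M) w t') \in s.
    by case: t' => [i|k' []]; apply: svw.
  split; first by apply: (CU s) => // i; apply: eP.
  apply: (CU (inverse s)) => [|c cC|i]; rewrite ?mem_inverse.
  + exact: order_iso_inverse.
  + exact: Cs.
  + exact: eP.
- by exists [::].
- exists (C ++ D) => s v w os CDs svw.
  have Cs : {in C, forall c, (c, c) \in s}.
    by move=> c cC; apply: CDs; rewrite mem_cat cC.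
  have Ds : {in D, forall c, (c, c) \in s}.
    by move=> c cD; apply: CDs; rewrite mem_cat cD orbT.
  have := IHf s v w os Cs svw; have := IHg s v w os Ds svw.
  by move=> /=; tauto.
- exists C => s v w os Cs svw.
  (* One implication for arbitrary data; the converse is this one applied to the inverse map. *)
  have main v' w' s' : order_iso s' -> {in C, forall c, (c, c) \in s'} ->
      (forall i, (v' i, w' i) \in s') ->
      sat (open_core M) w' (All f) -> sat (open_core M) v' (All f).
    move=> os' Cs' svw' /= H a.
    have [t [st ot /mapP[[a' b] + /= aa']]] := order_iso_extend a os'.
    rewrite -aa' => abt.
    apply/(IH t _ (env_cons b w')); last exact: H.
    + exact: ot.
    + by move=> c /Cs' /st.
    + by apply: (env_cons_rel (P := fun x y => (x, y) \in _)) => // i; apply: st.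
  split; last exact: main os Cs svw.
  apply: (main _ _ (inverse s)) => [|c cC|i]; rewrite ?mem_inverse //.
    exact: order_iso_inverse.
  exact: Cs.
Qed.

End OpenDefinable.

(** * Finite unions of points and intervals *)

Section FiniteUnions.
Context (d : Order.disp_t) (T : orderType d).

Definition finite_union_of_intervals (X : set T) :=
  exists (pts : seq T) (itvs : seq (interval T)),
    X = [set` pts] `|` \bigcup_(i in [set` itvs]) [set` i].

Lemma finite_unionU (X Y : set T) :
  finite_union_of_intervals X -> finite_union_of_intervals Y ->
  finite_union_of_intervals (X `|` Y).
Proof.
move=> [p [i ->]] [q [j ->]]; exists (p ++ q), (i ++ j).
have catU (A : choiceType) (r s : seq A) : [set` r ++ s] = [set` r] `|` [set` s].
  by apply/seteqP; split => x /=; rewrite mem_cat => /orP.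
by rewrite !catU bigcup_setU setUACA.
Qed.

Lemma finite_union_itv (i : interval T) : finite_union_of_intervals [set` i].
Proof.
exists [::], [:: i]; rewrite set_nil set0U.
by apply/seteqP; split=> [x xi|x [j /=]];
  [exists i => //=; rewrite mem_head | rewrite inE => /eqP ->].
Qed.

Lemma finite_union_set0 : finite_union_of_intervals set0.
Proof.
by exists [::], [::]; rewrite !set_nil bigcup_set0 setU0.
Qed.

(** The points of [C] cut the line into finitely many pieces, each contained in [X] or disjoint from
    it. *)
Lemma finite_union_of_cuts (C : seq T) (X : set T) :
  (forall x y, {in C, forall c, (x < c)%O = (y < c)%O /\ (c < x)%O = (c < y)%O} ->
     X x -> X y) ->
  finite_union_of_intervals X.
Proof.
move=> Xcut; suff H (i : interval T) : finite_union_of_intervals (X `&` [set` i]).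
  by have := H `]-oo, +oo[%O; rewrite set_itvE setIT.
have {Xcut} : forall x y, x \in i -> y \in i ->
    {in C, forall c, (x < c)%O = (y < c)%O /\ (c < x)%O = (c < y)%O} ->
    X x -> X y by move=> x y _ _; apply: Xcut.
elim: C i => [|c C IH] i Xi.
  have [[x [Xx xi]]|X0] := pselect (exists x, X x /\ x \in i).
    rewrite (_ : X `&` _ = [set` i]); first exact: finite_union_itv.
    by apply/seteqP; split=> [y []//|y yi]; split=> //; apply: (Xi x).
  rewrite (_ : X `&` _ = set0); first exact: finite_union_set0.
  by apply/seteqP; split=> // y [Xy yi]; apply: X0; exists y.
have -> : X `&` [set` i] = (X `&` [set` (i `&` `]-oo, c[)%O]) `|`
    ((X `&` [set` (i `&` `[c, c])%O]) `|` (X `&` [set` (i `&` `]c, +oo[)%O])).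
  apply/seteqP; split=> [x [Xx xi]|x]; last first.
    by move=> [|[|]] [Xx] /=; rewrite in_itvI => /andP[].
  have xi' : x \in i by [].
  have [xc|cx|xc] := ltgtP x c; [left|right;right|right;left]; split=> //=.
  - by rewrite in_itvI xi' in_itv /= xc.
  - by rewrite in_itvI xi' in_itv /= cx.
  - by rewrite in_itvI xi' in_itv /= xc lexx.
do !apply: finite_unionU; apply: IH => x y;
  rewrite !in_itvI => /andP[xi +] /andP[yi +]; rewrite !in_itv /= ?andbT;
  move=> xc yc Cxy; apply: Xi => // b;
  rewrite inE => /orP[/eqP ->|/Cxy//].
- by rewrite xc yc !ltNge !ltW.
- by move: xc yc; rewrite -!eq_le => /eqP <- /eqP <-.
- by rewrite xc yc !ltNge !ltW.
Qed.

End FiniteUnions.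

Lemma o_minimal_open_core_classes (R : realFieldType) (K : R -> seq R) :
  generic_classes K ->
  o_minimal (open_core (class_structure K : structure _ (order_topology R))).
Proof.
move=> Kgen X [m [phi [p defX]]].
have [C CX] := sat_open_core_iso Kgen phi.
apply: (@finite_union_of_cuts _ _ (C ++ [seq p i | i <- enum 'I_m])) => x y xy.
(* The identity on [C] and the parameters together with the pair [(x, y)] is an order isomorphism,
   as [x] and [y] lie in the same cut. *)
pose s : seq (R * R) := (x, y) ::
  [seq (c, c) | c <- C ++ [seq p i | i <- enum 'I_m]].
have os : order_iso s.
  move=> q r; rewrite !inE => /orP[/eqP->|/mapP[c cC ->]].
    move=> /orP[/eqP->|/mapP[e eC ->]] /=; first by rewrite !ltxx.
    by have [] := xy e eC.
  move=> /orP[/eqP->|/mapP[e eC ->]] //=.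
  by have [] := xy c cC.
have XE z : X z <->
    sat (open_core (class_structure K : structure _ (order_topology R)))
      (env_cat (fun=> z) p) phi.
  by have /seteqP[XS SX] := defX; split; [apply: XS | move=> /SX].
move=> /XE Xx; apply/XE.
apply/(CX s (env_cat (fun=> x) p)) => //.
- by move=> c cC; rewrite inE (map_f (fun c => (c, c))) ?orbT // mem_cat cC.
- apply: (env_cat_rel (P := fun x y => (x, y) \in _)) => i; first exact: mem_head.
  rewrite inE; apply/orP; right; apply: (map_f (fun c => (c, c))).
  by rewrite mem_cat map_f ?orbT // mem_enum.
Qed.

(** * Ultrapowers *)

(* A non-principal ultrafilter: it contains the cofinite sets. *)
Definition ufilter : set_system nat :=
  projT1 (cid (ultraFilterLemma eventually_filter)).

#[local] Instance ufilter_ultra : UltraFilter ufilter.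
Proof. by rewrite /ufilter; case: cid => F []. Qed.

Lemma ufilter_ge N : ufilter [set n | (N <= n)%N].
Proof.
rewrite /ufilter; case: cid => F [_] /=; apply.
by exists N => // n /=.
Qed.

Lemma ufilterT (A : set nat) : (forall n, A n) -> ufilter A.
Proof. by move=> AT; apply: filterS filterT => n _; apply: AT. Qed.

Lemma ufilterI (A B : set nat) : ufilter A -> ufilter B -> ufilter (A `&` B).
Proof. exact: filterI. Qed.

Lemma ufilterI_ex (A B : set nat) :
  ufilter A -> ufilter B -> exists n, A n /\ B n.
Proof. by move=> UA UB; apply: (@filter_ex _ ufilter); apply: ufilterI. Qed.

Lemma ufilterC (A : set nat) : ufilter (~` A) <-> ~ ufilter A.
Proof.
split=> [UC UA|NA]; last by have [] := in_ultra_setVsetC A ufilter_ultra.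
by have [n []] := ufilterI_ex UA UC.
Qed.

Section Ultrapower.
Context (T : choiceType).
Implicit Types f g : nat -> T.

Definition ae_eq f g := `[< ufilter [set n | f n = g n] >].

Lemma ae_eq_refl : reflexive ae_eq.
Proof. by move=> f; apply/asboolP; exact: ufilterT. Qed.

Lemma ae_eq_sym : symmetric ae_eq.
Proof.
by move=> f g; apply/asboolP/asboolP; apply: filterS => n /= ->.
Qed.

Lemma ae_eq_trans : transitive ae_eq.
Proof.
move=> g f h /asboolP fg /asboolP gh; apply/asboolP.
by apply: filterS2 fg gh => n /= -> ->.
Qed.

Canonical ae_eq_equiv := EquivRel ae_eq ae_eq_refl ae_eq_sym ae_eq_trans.

Definition ultrapower := {eq_quot ae_eq}.
HB.instance Definition _ := Choice.on ultrapower.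

Definition class_of_seq f : ultrapower := \pi_{eq_quot ae_eq} f.
Definition seq_of_class (x : ultrapower) : nat -> T :=
  repr (x : {eq_quot ae_eq}).

Lemma seq_of_classK f : ufilter [set n | seq_of_class (class_of_seq f) n = f n].
Proof.
apply/asboolP; rewrite -/(ae_eq (seq_of_class (class_of_seq f)) f).
by apply/eqquotP; exact: reprK.
Qed.

Lemma ultrapower_eq (x y : ultrapower) :
  x = y <-> ufilter [set n | seq_of_class x n = seq_of_class y n].
Proof.
split=> [->|xy]; first exact: ufilterT.
rewrite -[x](@reprK _ {eq_quot ae_eq}) -[y](@reprK _ {eq_quot ae_eq}).
by apply/eqquotP/asboolP.
Qed.

Section Los.
Context (L : language) (M : structure L T).

(** Symbols are evaluated on chosen representatives, which makes them well defined on classes at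
    once. *)
Definition ultraproduct : structure L ultrapower :=
  {| fun_interp := fun k (f : fun_sym L k) x =>
       class_of_seq (fun n => fun_interp M f (fun i => seq_of_class (x i) n));
     rel_interp := fun k (r : rel_sym L k) =>
       [set x | ufilter [set n |
         rel_interp M r (fun i => seq_of_class (x i) n)]] |}.

Lemma ufilter_forall_ord k (P : 'I_k -> set nat) :
  (forall i, ufilter (P i)) -> ufilter [set n | forall i, P i n].
Proof. by move=> UP; apply: filter_forall. Qed.

Lemma eval_ultraproduct n (t : term L n) (v : 'I_n -> ultrapower) :
  ufilter [set k | seq_of_class (eval ultraproduct v t) k =
                   eval M (fun i => seq_of_class (v i) k) t].
Proof.
elim: t => [i|k f ts IH] /=; first exact: ufilterT.
have K := seq_of_classK (fun j =>
  fun_interp M f (fun i => seq_of_class (eval ultraproduct v (ts i)) j)).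
apply: filterS2 K (ufilter_forall_ord IH) => j /= -> E.
by congr (fun_interp M f _); apply/funext => i; rewrite E.
Qed.

(** Łoś's theorem for an ultrapower. *)
Lemma sat_ultraproduct n (phi : formula L n) (v : 'I_n -> ultrapower) :
  sat ultraproduct v phi <->
  ufilter [set k | sat M (fun i => seq_of_class (v i) k) phi].
Proof.
elim: phi v => {n} [n t u|n k r ts||n f IHf g IHg|n f IH] v /=.
- rewrite ultrapower_eq; have := eval_ultraproduct t v.
  have := eval_ultraproduct u v => Eu Et.
  split=> H; apply: filterS3 Eu Et H => j /=; first by move=> -> ->.
  by move=> -> -> ->.
- have Ets := ufilter_forall_ord (fun i => eval_ultraproduct (ts i) v).
  split=> H; apply: filterS2 Ets H => j /= E.
    by rewrite (funext E).
  by rewrite -(funext E).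
- by split=> // /filter_ex[].
- split=> [H|H /IHf UF].
    (* Either the premise holds on a set of the ultrafilter or its failure does; where it fails the
       implication is vacuous. *)
    have [/IHf/H/IHg UG|/ufilterC NF] :=
        pselect (ufilter [set k | sat M (fun i => seq_of_class (v i) k) f]).
      by apply: filterS UG => j /= Gj _.
    by apply: filterS NF => j /= Nf /Nf.
  by apply/IHg; apply: filterS2 UF H => j /= + H; apply: H.
- have consE (a : ultrapower) k :
      (fun i => seq_of_class (env_cons a v i) k) =
      env_cons (seq_of_class a k) (fun i => seq_of_class (v i) k).
    by apply/funext => i; rewrite /env_cons; case: unlift.
  split=> [H|H a]; last first.
    by apply/IH; apply: filterS H => k /= Hk; rewrite consE.
  apply: contrapT => /ufilterC NA.
  have [k0 /existsNP[a0 _]] := filter_ex NA.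
  (* A counterexample is chosen at every index that has one, with [a0] as default elsewhere; the
     class of this sequence refutes the universal formula in the ultrapower. *)
  have /choice[a aP] k : exists a : T,
      ~ (forall b, sat M (env_cons b (fun i => seq_of_class (v i) k)) f) ->
      ~ sat M (env_cons a (fun i => seq_of_class (v i) k)) f.
    have [Hk|/existsNP[b Nb]] := pselect (forall b,
        sat M (env_cons b (fun i => seq_of_class (v i) k)) f).
      by exists a0.
    by exists b.
  have /IH UH := H (class_of_seq a).
  have [k [/= [Hk ak] Nk]] := ufilterI_ex (ufilterI UH (seq_of_classK a)) NA.
  by apply: aP Nk _; rewrite -ak -consE.
Qed.

Lemma ultraproduct_elementarily_equivalent :
  elementarily_equivalent M ultraproduct.
Proof.
move=> phi; rewrite sat_ultraproduct.
have E k : (fun i => seq_of_class (@env_nil ultrapower i) k) = @env_nil T.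
  by apply/funext => -[].
split=> [Mphi|/filter_ex[k /=]]; last by rewrite E.
by apply: ufilterT => k /=; rewrite E.
Qed.

End Los.
End Ultrapower.

Section UltrapowerOrder.
Context (d : Order.disp_t) (T : orderType d).
Local Notation N := (ultrapower T).
Implicit Types x y z : N.

Definition ultra_le x y :=
  `[< ufilter [set n | (seq_of_class x n <= seq_of_class y n)%O] >].

Lemma ultra_le_refl : reflexive ultra_le.
Proof. by move=> x; apply/asboolP; apply: ufilterT => n /=. Qed.

Lemma ultra_le_anti : antisymmetric ultra_le.
Proof.
move=> x y /andP[/asboolP xy /asboolP yx]; apply/ultrapower_eq.
by apply: filterS2 xy yx => n /= xy yx; apply/le_anti/andP.
Qed.

Lemma ultra_le_trans : transitive ultra_le.
Proof.
move=> y x z /asboolP xy /asboolP yz; apply/asboolP.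
by apply: filterS2 xy yz => n /=; apply: le_trans.
Qed.

Lemma ultra_le_total : total ultra_le.
Proof.
move=> x y; have [xy|/ufilterC yx] :=
  pselect (ufilter [set n | (seq_of_class x n <= seq_of_class y n)%O]).
  by apply/orP; left; apply/asboolP.
apply/orP; right; apply/asboolP; apply: filterS yx => n /= /negP.
by rewrite -ltNge => /ltW.
Qed.

HB.instance Definition _ := Order.Le_isPOrder.Build d N
  ultra_le_refl ultra_le_anti ultra_le_trans.
HB.instance Definition _ := Order.POrder_isTotal.Build d N ultra_le_total.

Lemma ultra_ltP x y :
  (x < y)%O <-> ufilter [set n | (seq_of_class x n < seq_of_class y n)%O].
Proof.
rewrite ltNge; split=> [/asboolPn/ufilterC xy|xy].
  by apply: filterS xy => n /= /negP; rewrite -ltNge.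
apply/negP => /asboolP yx; have [n [/=]] := ufilterI_ex xy yx.
by rewrite ltNge => /negP.
Qed.

End UltrapowerOrder.

(** * Infinite discrete classes *)

Section DiscreteSets.
Context (d : Order.disp_t) (T : orderTopologicalType d).
Hypothesis dense : forall a b : T, (a < b)%O -> exists c, (a < c < b)%O.

(** As [x] ranges over all points, not only those of [X], the set is closed as well as discrete. *)
Definition isolating (X : set T) :=
  forall x, exists u v, (u < x < v)%O /\
    forall y, (u < y < v)%O -> X y -> y = x.

Lemma isolating_closed (X : set T) : isolating X -> closed X.
Proof.
move=> iX; rewrite -openC openE => x NXx.
have [u [v [uxv uvX]]] := iX x; rewrite /interior itv_nbhsE.
exists `]u, v[%O; first by split; rewrite ?in_itv.
by move=> y /=; rewrite in_itv => /uvX yx Xy; apply: NXx; rewrite -(yx Xy).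
Qed.

(** Otherwise density yields a point of the interval above [y], below [z] and so close to [y] that
    it contradicts isolation. *)
Lemma isolating_itv_subset1 (X : set T) (i : interval T) y z :
  isolating X -> [set` i] `<=` X -> y \in i -> z \in i -> ~ (y < z)%O.
Proof.
case: i => l r iX iXs; rewrite !itv_boundlr => /andP[ly yr] /andP[lz zr] yz.
have [u [v [/andP[uy yv] uvX]]] := iX y.
have [w /andP[yw]] : exists w, (y < w < Order.min v z)%O.
  by apply: dense; rewrite lt_min yv.
rewrite lt_min => /andP[wv wz].
suff wy : w = y by rewrite wy ltxx in yw.
apply: uvX; first by rewrite (lt_trans uy yw).
apply: iXs; rewrite /= itv_boundlr; apply/andP; split.
  by apply: le_trans ly _; rewrite leBSide /= ltW.
by apply: le_trans zr; rewrite leBSide /= ltW.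
Qed.

Lemma isolating_finite (X : set T) :
  isolating X -> finite_union_of_intervals X -> finite_set X.
Proof.
move=> iX [pts [itvs XE]]; rewrite XE finite_setU; split; first exact: finite_seq.
apply: bigcup_finite => [|i ii]; first exact: finite_seq.
have iXs : [set` i] `<=` X by move=> y yi; rewrite XE; right; exists i.
have [[y yi]|Ni] := pselect (exists y, y \in i); last first.
  suff -> : [set` i] = set0 by exact: finite_set0.
  by apply/seteqP; split=> // y yi; apply: Ni; exists y.
apply: (sub_finite_set (B := [set y])); last exact: finite_set1.
move=> z /= zi; have [zy|yz|//] := ltgtP z y.
  by case: (isolating_itv_subset1 iX iXs zi yi).
by case: (isolating_itv_subset1 iX iXs yi zi).
Qed.

(** The complement of [X] is open and definable, hence a relation symbol of the open core, and its
    negation defines [X] there. By o-minimality [X] would be finite. *)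
Lemma not_o_minimal_open_core (L : language) (M : structure L T) (X : set T) :
  definable1 M X -> isolating X -> infinite_set X -> ~ o_minimal (open_core M).
Proof.
move=> [m [phi [p defX]]] iX infX oM; apply/infX/isolating_finite => //.
apply: oM.
pose U : set {ptws 'I_1 -> T} := [set x | ~ X (x ord0)].
have oU : open U.
  have -> : U = (fun x : {ptws 'I_1 -> T} => x ord0) @^-1` (~` X) by [].
  apply: open_comp => [x _|]; first exact: (@proj_continuous _ (fun=> T)).
  by rewrite openC; exact: isolating_closed.
have dU : definable M U.
  exists m, (Imp phi Bot), p; apply/funext => x /=.
  by rewrite /U /=; have := congr1 (@^~ x) defX => /= ->.
exists 0, (Imp (@Rel (open_core_language M) _ _ (exist _ U (conj oU dU))
  (fun i => Var _ (lshift 0 i))) Bot), (@env_nil T).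
apply/seteqP; split=> x /=.
  by rewrite /U /= env_cat_lshift => Xx /(_ Xx).
by rewrite /U /= env_cat_lshift => /contrapT.
Qed.

End DiscreteSets.

Lemma isolating_radius (R : realFieldType) (A : seq R) (x : R) :
  exists e, 0 < e /\ {in A, forall y, x - e < y < x + e -> y = x}.
Proof.
have [|e e0 eA] := @separate_above _ 0 [seq `|y - x| | y <- A & y != x].
  move=> _ /mapP[y + ->]; rewrite mem_filter => /andP[yx _].
  by rewrite normr_gt0 subr_eq0.
exists e; split=> // y yA yxe; apply/eqP/contraT => yx.
suff : `|y - x| < `|y - x| by rewrite ltxx.
apply: (@lt_trans _ _ e); first by rewrite ltr_norml; lra.
by apply: eA; apply: map_f; rewrite mem_filter yx.
Qed.

Lemma ultrapower_rat_dense (a b : ultrapower rat) :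
  (a < b)%O -> exists c, (a < c < b)%O.
Proof.
move=> /ultra_ltP ab.
pose c n := (seq_of_class a n + seq_of_class b n) / 2.
exists (class_of_seq c); apply/andP; split; apply/ultra_ltP;
  apply: filterS2 ab (seq_of_classK c) => n /= ab ->; rewrite /c; lra.
Qed.

Lemma ultrapower_rat_no_min (a : ultrapower rat) : exists b, (b < a)%O.
Proof.
pose b n := seq_of_class a n - 1.
exists (class_of_seq b); apply/ultra_ltP.
by apply: filterS (seq_of_classK b) => n /= ->; rewrite ltrBlDr ltrDl.
Qed.

Lemma ultrapower_rat_no_max (a : ultrapower rat) : exists b, (a < b)%O.
Proof.
pose b n := seq_of_class a n + 1.
exists (class_of_seq b); apply/ultra_ltP.
by apply: filterS (seq_of_classK b) => n /= ->; rewrite ltrDl.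
Qed.

(** * An infinite closed discrete class in the ultrapower *)

Section Counterexample.
Context (K : rat -> seq rat).
Let N : structure class_language (order_topology (ultrapower rat)) :=
  ultraproduct (class_structure K).

Definition class_in_ultrapower (a : ultrapower rat) : set (ultrapower rat) :=
  [set y | ufilter [set n | seq_of_class y n \in K (seq_of_class a n)]].

Lemma definable_class a :
  definable1 N (class_in_ultrapower a : set (order_topology (ultrapower rat))).
Proof.
(* [ClassSym] takes the representative of the class first, whereas [env_cat] puts the parameter
   last; hence the swap of the variables. *)
exists 1, (@Rel class_language _ 2 ClassSym (fun i =>
  Var class_language (if i == ord0 then rshift 1 ord0 else lshift 1 ord0))).
exists (fun=> a); apply/funext => x /=.
by rewrite env_cat_rshift env_cat_lshift.
Qed.

(** Each factor is a finite list, isolated around the [n]-th coordinate of [x] with some radius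
    [e n]; these radii give the endpoints coordinatewise. *)
Lemma isolating_class a :
  isolating (class_in_ultrapower a : set (order_topology (ultrapower rat))).
Proof.
move=> x.
have /choice[e eP] n := isolating_radius (K (seq_of_class a n)) (seq_of_class x n).
pose u n := seq_of_class x n - e n; pose v n := seq_of_class x n + e n.
exists (class_of_seq u), (class_of_seq v); split.
  apply/andP; split; apply/ultra_ltP.
    apply: filterS (seq_of_classK u) => n /= ->.
    by rewrite /u ltrBlDr ltrDl; have [] := eP n.
  apply: filterS (seq_of_classK v) => n /= ->.
  by rewrite /v ltrDl; have [] := eP n.
move=> y /andP[/ultra_ltP uy /ultra_ltP yv] ay; apply/ultrapower_eq.
have uvy := ufilterI (ufilterI uy (seq_of_classK u))
  (ufilterI yv (seq_of_classK v)).
apply: filterS (ufilterI uvy ay) => n /= [[[+ uE] [+ vE]] Kay].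
rewrite uE vE => uy' yv'; have [_] := eP n; apply=> //.
by rewrite uy'.
Qed.

Lemma infinite_class : generic_classes K ->
  exists a, infinite_set (class_in_ultrapower a).
Proof.
move=> Kgen; have /choice[b bP] n : exists b : seq rat,
    [/\ size b = n, uniq b & {in b, forall x, K x = b}].
  (* Repeating one interval [n] times gives a class with exactly [n] elements. *)
  case: Kgen => _ _ _ /(_ (nseq n (0, 1)))[|b [sb ub Kb _]].
    by move=> _ /nseqP[-> _].
  by exists b; rewrite size_nseq in sb.
exists (class_of_seq (fun n => (b n)`_0)).
(* The [i]-th elements of the classes [b n] are genuine for [n > i], hence almost everywhere; the
   default value 0 at the finitely many other indices is harmless. *)
pose e i := class_of_seq (fun n => (b n)`_i).
have einj i j : e i = e j -> i = j.
  move=> /ultrapower_eq eij; pose bi i n := (b n)`_i.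
  have bij := ufilterI (seq_of_classK (bi i)) (seq_of_classK (bi j)).
  have big := ufilterI (ufilter_ge i.+1) (ufilter_ge j.+1).
  have [n [/= eijn [[iE jE] [ni nj]]]] := ufilterI_ex eij (ufilterI bij big).
  have [sb ub _] := bP n; move: eijn; rewrite iE jE /bi => /eqP.
  by rewrite nth_uniq ?sb // => /eqP.
have eX : e @^-1` class_in_ultrapower (class_of_seq (fun n => (b n)`_0)) = setT.
  apply/seteqP; split=> // i _; rewrite /class_in_ultrapower /=.
  have bi := ufilterI (seq_of_classK (fun n => (b n)`_i))
    (seq_of_classK (fun n => (b n)`_0)).
  apply: filterS2 bi (ufilter_ge i.+1) => n /= [-> ->] ni.
  by have [sb _ Kb] := bP n; rewrite Kb mem_nth ?sb // (leq_trans _ ni).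
move=> /(finite_preimage (f := e)); rewrite eX => fin.
by apply/infinite_nat/fin => i j _ _; apply: einj.
Qed.

End Counterexample.

Lemma rat_dense (a b : rat) : a < b -> exists c, a < c < b.
Proof. by move=> ab; exists ((a + b) / 2); lra. Qed.

Lemma rat_no_min (a : rat) : exists b, b < a.
Proof. by exists (a - 1); lra. Qed.

Lemma rat_no_max (a : rat) : exists b, a < b.
Proof. by exists (a + 1); lra. Qed.

(** Left transparent so that carrier and interpretation unfold when elementarity is applied. *)
Definition class_dlo (K : rat -> seq rat) : dlo_structure class_language.
Proof.
apply: (@DloStructure class_language _ (order_topology rat) (class_structure K)).
- by [].
- exact: rat_dense.
- exact: rat_no_min.
- exact: rat_no_max.
- exact: (inhabits (0 : rat)).
Defined.

Definition class_ultrapower_dlo (K : rat -> seq rat) :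
  dlo_structure class_language.
Proof.
apply: (@DloStructure class_language _ (order_topology (ultrapower rat))
  (ultraproduct (class_structure K))).
- by move=> x; split=> /ultra_ltP.
- exact: ultrapower_rat_dense.
- exact: ultrapower_rat_no_min.
- exact: ultrapower_rat_no_max.
- exact: (inhabits (class_of_seq (fun=> 0 : rat))).
Defined.

Theorem theorem1p1 : ~ elementary has_o_minimal_open_core.
Proof.
move=> elem; have [K Kgen] := generic_classes_exist.
have [a infa] := infinite_class Kgen.
have := not_o_minimal_open_core
  (T := order_topology (ultrapower rat)) ultrapower_rat_dense
  (definable_class K a) (@isolating_class K a) infa.
apply; apply: (elem _ (class_dlo K) (class_ultrapower_dlo K)).
  exact: ultraproduct_elementarily_equivalent.
exact: o_minimal_open_core_classes.
Qed.
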